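(* Let $\mathcal{C}$ be any class of finite groups such that $$\{G : G \text{ has square-free order}\}\subseteq \mathcal{C}\subseteq \{G : G \text{ is metanilpotent}\},$$ and let $F$ be a finite simple undirected graph. Then $F$ is isomorphic to the codegree prime graph $\Delta_{\mathrm{cod}}(G)$ of some $G\in\mathcal{C}$ if and only if the complement $\overline{F}$ is bipartite.
   Context: All groups are finite. A group is metanilpotent if it has a nilpotent normal subgroup with nilpotent quotient. For a finite group $G$, $\mathrm{Irr}(G)$ is the set of irreducible complex characters of $G$. For $\chi\in\mathrm{Irr}(G)$ the codegree of $\chi$ is $\mathrm{cod}(\chi)=|G:\ker(\chi)|/\chi(1)$, and $\mathrm{cod}(G)=\{\mathrm{cod}(\chi) : \chi\in\mathrm{Irr}(G)\}$. The codegree prime graph $\Delta_{\mathrm{cod}}(G)$ is the simple undirected graph whose vertices are the prime divisors of the numbers in $\mathrm{cod}(G)$, two distinct vertices $p,q$ being adjacent if and only if $pq$ divides some number in $\mathrm{cod}(G)$. A graph is bipartite if it is $2$-colorable. *)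

(* Defs.v *)
From mathcomp Require Import all_boot all_order all_algebra all_fingroup.
From mathcomp Require Import all_solvable all_field all_character.

Set Implicit Arguments.
Unset Strict Implicit.
Unset Printing Implicit Defensive.

Import Order.TTheory GRing.Theory Num.Theory.

Local Open Scope ring_scope.

Record sgraph := SGraph {
  vertex :> finType;
  edge : rel vertex;
  edge_sym : symmetric edge;
  edge_irr : irreflexive edge
}.

Definition graph_iso (F H : sgraph) : Prop :=
  exists2 f : F -> H, bijective f & forall x y, edge (f x) (f y) = edge x y.

Section Complement.

Variable F : sgraph.

Definition compl_edge : rel F := [rel x y | (x != y) && ~~ edge x y].

Lemma compl_edge_sym : symmetric compl_edge.
Proof. by move=> x y; rewrite /compl_edge /= eq_sym edge_sym. Qed.

Lemma compl_edge_irr : irreflexive compl_edge.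
Proof. by move=> x; rewrite /compl_edge /= eqxx. Qed.

Definition compl_graph : sgraph := SGraph compl_edge_sym compl_edge_irr.

End Complement.

Definition bipartite (F : sgraph) : Prop :=
  exists c : F -> bool, forall x y, edge x y -> c x != c y.

Definition square_free (n : nat) : Prop :=
  forall d : nat, (d ^ 2 %| n)%N -> d = 1%N.

Definition metanilpotent (gT : finGroupType) (G : {group gT}) : Prop :=
  exists N : {group gT}, [/\ N <| G, nilpotent N & nilpotent (G / N)]%g.

Section Codegree.

Variables (gT : finGroupType) (G : {group gT}).

(* The truncation only serves to land in nat: by codegreeE below, the quotient
   is already a natural number when phi is irreducible. *)
Definition codegree (phi : 'CF(G)) : nat :=
  Num.truncn (#|G : cfker phi|%g%:R / phi 1%g).

Lemma codegreeE (i : Iirr G) :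
  (codegree 'chi_i)%:R = #|G : cfker 'chi_i|%g%:R / 'chi_i 1%g :> algC.
Proof.
have cNat: #|G : cfker 'chi_i|%g%:R / 'chi_i 1%g \is a @Num.nat algC.
  have /dvdCP_nat: ('chi_i 1%g %| #|G : cfker 'chi_i|%g%:R)%C.
    apply: dvdC_trans (dvd_irr1_index_center i) _.
    rewrite dvdC_nat; apply: indexgS.
    exact: normal_sub (cfker_center_normal _).
  rewrite ler0n char1_ge0 ?irr_char // => /(_ isT isT)[n ->].
  by rewrite mulfK ?irr1_neq0 ?natr_nat.
by rewrite /codegree truncnK.
Qed.

Definition cod : seq nat := [seq codegree 'chi_i | i : Iirr G].

Definition cod_primes : seq nat := undup (flatten [seq primes n | n <- cod]).

Definition cod_edge : rel (seq_sub cod_primes) :=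
  [rel p q | (p != q) && has (fun n => (val p * val q %| n)%N) cod].

Lemma cod_edge_sym : symmetric cod_edge.
Proof.
move=> p q; rewrite /cod_edge /= eq_sym; congr (_ && _).
by apply: eq_has => n; rewrite mulnC.
Qed.

Lemma cod_edge_irr : irreflexive cod_edge.
Proof. by move=> p; rewrite /cod_edge /= eqxx. Qed.

Definition Delta_cod : sgraph := SGraph cod_edge_sym cod_edge_irr.

(* primes 0 is empty, so this relies on codegrees being positive. *)
Lemma mem_cod_primes p :
  (p \in cod_primes) = prime p && has (fun n => (p %| n)%N) cod.
Proof.
have cod_gt0 n : n \in cod -> (0 < n)%N.
  case/imageP=> i _ ->; rewrite -(ltr0n algC) codegreeE.
  by rewrite divr_gt0 ?irr1_gt0 // ltr0n indexg_gt0.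
rewrite mem_undup; apply/flatten_mapP/andP.
  case=> n cod_n; rewrite mem_primes => /and3P[p_pr _ p_n].
  by split=> //; apply/hasP; exists n.
case=> p_pr /hasP[n cod_n p_n]; exists n => //.
by rewrite mem_primes p_pr cod_gt0.
Qed.

End Codegree.

(* Main.v *)
Require Import Defs.
From mathcomp Require Import all_boot all_order all_algebra all_fingroup.
From mathcomp Require Import all_solvable all_field all_character.

Set Implicit Arguments.
Unset Strict Implicit.
Unset Printing Implicit Defensive.

Import Order.TTheory GRing.Theory Num.Theory.

(** Edges of the codegree graph come from linear characters.  Let K <| H <| G
    with H / K nilpotent.  Some linear character lambda of H has order divisible
    by every prime divisor of |H : K|, because a nilpotent group and its
    abelianization have the same prime divisors and an abelian group (here the
    group of linear characters of H) contains an element whose order is its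
    exponent.  If chi lies over lambda, Clifford theory shows that chi(1)
    divides |G : H|, while |H : ker lambda| divides |G : ker chi|.  Hence cod
    chi is divisible by all primes that divide |H : K| but not |G : H|
    ([codegree_dvd_primes]); any two of these are adjacent.

    For the direct implication, let N <| G be nilpotent with G / N nilpotent.
    The pair (H, K) = (G, N) shows that the primes dividing |G : N| form a
    clique, and (H, K) = (N, 1) shows the same for the other prime divisors of
    |G|.  So divisibility of |G : N| is a 2-coloring of the complement.

    For the converse, let c be a 2-coloring of the complement of F.  Attach to
    the vertices v pairwise distinct primes p_v and q_v, and let m be the
    product of the p_v over one color class and n the product of the q_w over
    the other.  The group realizing F is <[x]> ><| <[y]> with x of order m, y
    of order n and x ^ y = x ^+ e, where e is chosen such that the subgroup of
    order q_w of <[y]> centralizes the subgroup of order p_v of <[x]> exactly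
    when v and w are adjacent in F.  Both color classes are cliques by the
    argument above, and so is {p_v, q_w} if v and w are adjacent, as <[x]> times
    the subgroup of order q_w is normal and has a cyclic quotient of order
    p_v q_w.  If v and w are not adjacent, a character chi with p_v dividing
    cod chi restricts nontrivially to the subgroup P of order p_v; the inertia
    group of a nontrivial character of P centralizes P, so q_w divides its
    index, hence chi(1), and since |G| is square-free q_w cannot divide cod chi
    ([codegree_ndvd_primes]).

    The primes p_v must admit an element of prescribed order d modulo p_v.  They
    are found as prime divisors of values of the cyclotomic polynomial Phi_d at
    multiples of d * N`! ([prime_with_exact_order]), and the residues are glued
    by the Chinese remainder theorem. *)

(** * Degrees and codegrees over a linear character *)

Section CodegreeDivisors.

Local Open Scope ring_scope.
Local Open Scope nat_scope.
Local Open Scope group_scope.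

Variable gT : finGroupType.
Implicit Types G H K P : {group gT}.

Lemma irr1_codegree G (i : Iirr G) :
  exists2 d : nat, 'chi_i 1%g = (d%:R)%R
                 & (d * codegree 'chi_i)%N = #|G : cfker 'chi_i|.
Proof.
have /natrP[d chi1] := Cnat_irr1 i; exists d => //.
apply/eqP; rewrite -(eqr_nat algC) natrM codegreeE -chi1 mulrC divfK //.
exact: irr1_neq0.
Qed.

Lemma codegree_dvd_index_ker G (i : Iirr G) :
  codegree 'chi_i %| #|G : cfker 'chi_i|.
Proof. by have [d _ <-] := irr1_codegree i; rewrite dvdn_mull. Qed.

(** The part of the Clifford correspondence used below: chi is induced from a
    character psi of the inertia group T of theta lying over theta, and psi is
    homogeneous on H because theta is T-invariant. *)
Lemma Clifford_correspondent G H (i : Iirr G) (j : Iirr H) :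
    H <| G -> j \in irr_constt ('Res[H] 'chi_i) ->
  exists2 s : Iirr 'I_G['chi_j],
    ('chi_i 1%g = #|G : 'I_G['chi_j]|%:R * 'chi_s 1%g)%R
  & exists a, ('Res[H] 'chi_s = a *: 'chi_j)%R.
Proof.
move=> nsHG; rewrite -constt_Ind_Res => iGj.
have [irrInd _ imInd _ _] := constt_Inertia_bijection j nsHG.
move: iGj; rewrite -imInd => /imsetP[s sTj ->]; exists s.
  by rewrite cfIirrE ?irrInd // cfInd1 ?subsetIl.
have nsHT := normal_Inertia 'chi_j (normal_sub nsHG).
move: sTj; rewrite constt_Ind_Res => /(Clifford_Res_sum_cfclass nsHT) ->.
rewrite cfclass_invariant ?subsetIr // big_seq1.
by eexists.
Qed.

(** With psi the Clifford correspondent of chi, chi(1) = |G : T| psi(1).  On H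
    the character psi is a multiple of the linear character lambda, so H acts
    by scalars and is contained in the center Z(psi); thus psi(1) divides
    |T : Z(psi)|, which divides |T : H|.  When H is abelian this is a theorem of
    Ito. *)
Lemma irr1_dvd_index_linear G H (i : Iirr G) (j : Iirr H) d :
    H <| G -> j \in irr_constt ('Res[H] 'chi_i) ->
    'chi_j \is a linear_char -> 'chi_i 1%g = (d%:R)%R ->
  d %| #|G : H|.
Proof.
move=> nsHG iHj lin_j chi1.
have sHG := normal_sub nsHG; have sHT := sub_Inertia 'chi_j sHG.
have [s degi [a Ress]] := Clifford_correspondent nsHG iHj.
suffices: ('chi_i 1%g %| #|G : H|)%C by rewrite chi1 dvdC_nat.
rewrite degi -(Lagrange_index (subsetIl _ _) sHT).
rewrite [X in (_ %| X)%C]natrM.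
rewrite dvdC_mul2l ?pnatr_eq0 -?lt0n ?indexg_gt0 //.
apply: dvdC_trans (dvd_irr1_index_center s) _.
rewrite [X in is_true X](dvdC_nat _ _) indexgS //; apply/subsetP=> h Hh.
have s_h x : x \in H -> ('chi_s x = a * 'chi_j x)%R.
  by move=> Hx; rewrite -(cfResE _ sHT) // Ress cfunE.
rewrite irr_cfcenterE ?(subsetP sHT) // !s_h // (lin_char1 lin_j) mulr1.
rewrite normrM normC_lin_char // mulr1 -(mulr1 a) -(lin_char1 lin_j) -s_h //.
by rewrite ger0_norm // ltW // irr1_gt0.
Qed.

(** The linear characters form an abelian group of order |H : H'|.  It has an
    element of order equal to its exponent, which involves all prime divisors
    of the group order. *)
Lemma linear_char_full_order H :
  exists2 j : Iirr H, 'chi_j \is a linear_char &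
    forall p, prime p -> p %| #|H : H^`(1)| -> p %| #|H : cfker 'chi_j|.
Proof.
have [L [cF [cF_inj oL linF _] [_ cM _ _ oF]]] := lin_char_group H.
have abL : abelian [set: L].
  by apply/centsP=> u _ v _; apply: cF_inj; rewrite !cM mulrC.
have [u _ expL] := exponent_witness (abelian_nil abL).
have /irrP[j Dj] := lin_char_irr (linF u).
exists j => [|p p_pr]; first by rewrite -Dj.
rewrite -oL -cardsT => p_L; have: p \in \pi(exponent [set: L]).
  by rewrite pi_of_exponent mem_primes p_pr cardG_gt0.
rewrite mem_primes => /and3P[_ _].
rewrite expL -oF Dj cforder_lin_char -?Dj // => /dvdn_trans -> //.
by rewrite (dvdn_trans (exponent_dvdn _)) // card_quotient ?cfker_norm.
Qed.

(** For L = H / K nilpotent and p dividing |L|, the largest p-quotient of L is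
    nontrivial, and a nontrivial p-group is not perfect. *)
Lemma nilpotent_quotient_index_der1 p H K :
    prime p -> K <| H -> nilpotent (H / K) -> p %| #|H : K| ->
  p %| #|H : H^`(1)|.
Proof.
move=> p_pr nsKH nilHK; rewrite -card_quotient ?normal_norm // => p_HK.
set L := H / K in nilHK p_HK.
have L_H' : #|L : L^`(1)| %| #|H : H^`(1)|.
  rewrite /L -quotient_der ?normal_norm // index_quotient //.
  exact: subset_trans (subsetIl _ _) (normal_norm nsKH).
apply: dvdn_trans L_H'.
pose M := L / 'O_p^'(L).
have hallO : p^'.-Hall(L) 'O_p^'(L) := nilpotent_pcore_Hall _ nilHK.
have nOL : L \subset 'N('O_p^'(L)) := gFnorm _ _.
have pM : p.-group M.
  rewrite /pgroup /M card_quotient // -(eq_pnat _ (negnK _)).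
  by case/and3P: hallO.
have ntM : M != 1.
  apply: contraTneq p_HK => /eqP; rewrite -subG1 quotient_sub1 // => sLO.
  by rewrite -p'natE //; apply: pgroupS sLO (pcore_pgroup _ _).
have M_L' : #|M : M^`(1)| %| #|L : L^`(1)|.
  by rewrite /M -quotient_der // index_quotient // (subset_trans (subsetIl _ _)).
apply: dvdn_trans M_L'.
have ltM' : M^`(1) \proper M.
  by rewrite (sol_der1_proper (nilpotent_sol (pgroup_nil pM))).
have : p.-nat #|M : M^`(1)| by apply: pnat_dvd (dvdn_indexg _ _) pM.
case/p_natP=> // -[|k] oM'; last by rewrite oM' expnS dvdn_mulr.
by have := proper_subn ltM'; rewrite -indexg_eq1 oM'.
Qed.

(** The source of all edges.  The character chi lies over the linear character
    of [linear_char_full_order]: the primes in question divide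
    chi(1) * cod chi = |G : ker chi| and do not divide chi(1). *)
Lemma codegree_dvd_primes G H K :
    H <| G -> K <| H -> nilpotent (H / K) ->
  exists i : Iirr G, forall p, prime p -> p %| #|H : K| -> ~~ (p %| #|G : H|) ->
    p %| codegree 'chi_i.
Proof.
move=> nsHG nsKH nilHK.
have [j lin_j dvd_j] := linear_char_full_order H.
have [i jGi] := constt_cfInd_irr j (normal_sub nsHG).
rewrite constt_Ind_Res in jGi.
exists i => p p_pr p_HK p'GH.
have p_ker := dvd_j p p_pr (nilpotent_quotient_index_der1 p_pr nsKH nilHK p_HK).
have [d chi1 defGK] := irr1_codegree i.
have := irr1_dvd_index_linear nsHG jGi lin_j chi1 => d_GH.
have: p %| (d * codegree 'chi_i)%N.
  rewrite defGK (dvdn_trans p_ker) //.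
  apply: (@dvdn_trans #|H : H :&: cfker 'chi_i|).
    apply: indexgS; rewrite /= -(cfker_Res (normal_sub nsHG)) ?irr_char //.
    by rewrite cfker_constt ?cfRes_char ?irr_char.
  have nKH : H \subset 'N(cfker 'chi_i).
    exact: subset_trans (normal_sub nsHG) (cfker_norm _).
  rewrite indexgI -(card_quotient nKH) -(card_quotient (cfker_norm _)).
  by rewrite cardSg // quotientS // normal_sub.
rewrite Euclid_dvdM // => /orP[p_d | //].
by rewrite (dvdn_trans p_d d_GH) in p'GH.
Qed.

(** The source of all non-edges.  If p divides cod chi then chi is not trivial
    on P, so it lies over some faithful lambda of P, whose inertia group is
    contained in the centralizer of P.  Thus q divides chi(1), and as q ^ 2 does
    not divide |G : ker chi| = chi(1) * cod chi, it does not divide cod chi. *)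
Lemma codegree_ndvd_primes G P (i : Iirr G) p q :
    P <| G -> #|P| = p -> prime p -> prime q -> q %| #|G : 'C_G(P)| ->
    ~~ (p ^ 2 %| #|G|) -> ~~ (q ^ 2 %| #|G|) ->
  ~~ (p * q %| codegree 'chi_i).
Proof.
move=> nsPG oP p_pr q_pr q_GC p2'G q2'G; apply/negP=> pq_cod.
have sPG := normal_sub nsPG.
have not_sPker : ~~ (P \subset cfker 'chi_i).
  apply: contra p2'G => sPker.
  rewrite -(Lagrange (cfker_sub 'chi_i)) expnS expn1 dvdn_mul //.
    by rewrite -[in X in X %| _]oP cardSg.
  rewrite (dvdn_trans _ (codegree_dvd_index_ker i)) //.
  exact: dvdn_trans (dvdn_mulr _ _) pq_cod.
have [j jP nz_j] : exists2 j, j \in irr_constt ('Res[P] 'chi_i) & j != 0%R.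
  have [j jP] := neq0_has_constt (Res_irr_neq0 P i).
  exists j => //; apply: contra not_sPker => /eqP j0.
  by apply: constt0_Res_cfker => //; rewrite -j0.
have [s degi _] := Clifford_correspondent nsPG jP.
have sTC : 'I_G['chi_j] \subset 'C_G(P).
  rewrite subsetI subsetIl /=; apply/centsP=> y /setIP[Gy Ty] x Px.
  have /irr_prime_injP := nz_j; rewrite oP => /(_ p_pr) inj_j.
  (* A nontrivial character of a group of prime order is injective. *)
  apply/esym/commgP/conjg_fixP/inj_j => //; last exact: inertia_valJ.
  by rewrite memJ_norm // (subsetP (normal_norm nsPG)).
have [d chi1 defGK] := irr1_codegree i.
have q_d : q %| d.
  rewrite (dvdn_trans q_GC) // (dvdn_trans (indexgS _ sTC)) //.
  have /natrP[c chis] := Cnat_irr1 s.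
  move: degi; rewrite chi1 chis -natrM => /eqP; rewrite eqr_nat => /eqP->.
  exact: dvdn_mulr.
case/negP: q2'G; apply: (@dvdn_trans (d * codegree 'chi_i)%N).
  by rewrite expnS expn1 dvdn_mul // (dvdn_trans _ pq_cod) ?dvdn_mull.
by rewrite defGK dvdn_indexg.
Qed.

End CodegreeDivisors.

(** * Cliques in the codegree graph of a metanilpotent group *)

Section Edges.

Local Open Scope ring_scope.
Local Open Scope nat_scope.
Local Open Scope group_scope.

Variable gT : finGroupType.
Implicit Types G H K : {group gT}.

Lemma cod_primes_dvd G p : p \in cod_primes G -> prime p /\ p %| #|G|.
Proof.
rewrite mem_cod_primes => /andP[-> /hasP[_ /imageP[i _ ->] p_cod]]; split=> //.
rewrite (dvdn_trans p_cod) // (dvdn_trans (codegree_dvd_index_ker i)) //.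
exact: dvdn_indexg.
Qed.

Lemma prime_mem_cod_primes G H K p :
    H <| G -> K <| H -> nilpotent (H / K) ->
    prime p -> p %| #|H : K| -> ~~ (p %| #|G : H|) ->
  p \in cod_primes G.
Proof.
move=> nsHG nsKH nilHK p_pr p_HK p'GH.
have [i dvd_i] := codegree_dvd_primes nsHG nsKH nilHK.
rewrite mem_cod_primes p_pr; apply/hasP; exists (codegree 'chi_i).
  exact: image_f.
exact: dvd_i.
Qed.

Lemma primes_cod_adjacent G H K p q :
    H <| G -> K <| H -> nilpotent (H / K) -> p != q ->
    prime p -> p %| #|H : K| -> ~~ (p %| #|G : H|) ->
    prime q -> q %| #|H : K| -> ~~ (q %| #|G : H|) ->
  has (fun n => p * q %| n)%N (cod G).
Proof.
move=> nsHG nsKH nilHK neq_pq p_pr p_HK p'GH q_pr q_HK q'GH.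
have [i dvd_i] := codegree_dvd_primes nsHG nsKH nilHK.
apply/hasP; exists (codegree 'chi_i); first exact: image_f.
by rewrite Gauss_dvd ?dvd_i // prime_coprime // dvdn_prime2.
Qed.

(** The color of p records whether p divides |G : N|; both color classes are
    cliques of the codegree graph. *)
Lemma metanilpotent_compl_bipartite G :
  metanilpotent G -> bipartite (compl_graph (Delta_cod G)).
Proof.
case=> N [nsNG nilN nilGN].
exists (fun p => val p %| #|G : N|) => p q /= /andP[neq_pq].
apply: contra => /eqP eq_c; apply/andP; split=> //=.
have neq_v : val p != val q by rewrite (inj_eq val_inj).
have [p_pr p_G] := cod_primes_dvd (valP p).
have [q_pr q_G] := cod_primes_dvd (valP q).
have [p_GN | p'GN] := boolP (val p %| #|G : N|).
  apply: (primes_cod_adjacent (normal_refl G) nsNG) => //.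
  - by rewrite indexgg Euclid_dvd1.
  - by rewrite -eq_c.
  - by rewrite indexgg Euclid_dvd1.
have q'GN : ~~ (val q %| #|G : N|) by rewrite -eq_c.
rewrite -(Lagrange (normal_sub nsNG)) !Euclid_dvdM // in p_G q_G.
rewrite (negPf p'GN) (negPf q'GN) !orbF in p_G q_G.
apply: (primes_cod_adjacent nsNG (normal1 N)) => //; rewrite ?indexg1 //.
exact: quotient_nil.
Qed.

End Edges.

Lemma graph_iso_compl_bipartite (F H : sgraph) :
  graph_iso F H -> bipartite (compl_graph H) -> bipartite (compl_graph F).
Proof.
case=> f bij_f edge_f [c cP]; exists (c \o f) => x y /andP[neq_xy nadj_xy].
apply: cP; apply/andP; split; last by rewrite edge_f.
by rewrite (inj_eq (bij_inj bij_f)).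
Qed.

(** * Square-free numbers *)

Lemma sqfree_mul m n r :
    coprime m n -> prime r -> ~~ (r ^ 2 %| m) -> ~~ (r ^ 2 %| n) ->
  ~~ (r ^ 2 %| m * n).
Proof.
move=> co_mn r_pr r2'm r2'n; have [r_m | r'm] := boolP (r %| m).
  by rewrite Gauss_dvdl // coprimeXl // (coprime_dvdl r_m).
by rewrite Gauss_dvdr // coprimeXl // prime_coprime.
Qed.

Lemma square_free_primes N :
  (forall r, prime r -> ~~ (r ^ 2 %| N)) -> square_free N.
Proof.
move=> sqfN d d2_N; apply/eqP/contraT=> neq_d1.
have d_gt0 : 0 < d.
  rewrite lt0n; apply: contraL d2_N => /eqP->; rewrite dvd0n.
  by apply: contraNneq (sqfN 2 isT) => ->.
have r_pr : prime (pdiv d) by rewrite pdiv_prime // ltn_neqAle eq_sym neq_d1.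
case/negP: (sqfN _ r_pr); apply: dvdn_trans d2_N.
by rewrite dvdn_exp2r // pdiv_dvd.
Qed.

(** * Codegrees of split metacyclic groups *)

Section Metacyclic.

Local Open Scope ring_scope.
Local Open Scope nat_scope.
Local Open Scope group_scope.

Lemma order_eq_dvdn (gT : finGroupType) (x : gT) m :
  (forall k, (x ^+ k == 1) = (m %| k)) -> #[x] = m.
Proof.
move=> xP; apply/eqP; rewrite eqn_dvd order_dvdn xP dvdnn /=.
by rewrite -xP expg_order.
Qed.

(** On Z/m x Z/n take x : (i, j) |-> (i + 1, j) and y : (i, j) |-> (e i, j + 1).
    The condition on e makes y a permutation of order n. *)
Lemma split_metacyclic_exists m n e :
    0 < m -> 0 < n -> e ^ n = 1 %[mod m] ->
  exists (gT : finGroupType) (x y : gT), [/\ #[x] = m, #[y] = n & x ^ y = x ^+ e].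
Proof.
case: m => // m _; case: n => // n _ e_n.
pose T : finType := ('I_m.+1 * 'I_n.+1)%type.
have mulA (i : 'I_m.+1) k : (i *+ k)%R = inZp (i * k) by rewrite Zp_mulrn.
pose fx (u : T) : T := ((u.1 + inZp 1)%R, u.2).
pose fy (u : T) : T := ((u.1 *+ e)%R, (u.2 + inZp 1)%R).
have fx_inj : injective fx.
  case=> i j [i' j'] eq_f; congr (_, _);
    last exact: (congr1 (fun u : T => u.2) eq_f).
  exact: addIr (congr1 (fun u : T => u.1) eq_f).
have iter_fx k u : iter k fx u = ((u.1 + inZp 1 *+ k)%R, u.2).
  elim: k => [|k IHk]; first by rewrite mulr0n addr0 -surjective_pairing.
  by rewrite /= IHk /fx /= mulrSr addrA.
have iter_fy k u : iter k fy u = ((u.1 *+ (e ^ k))%R, (u.2 + inZp 1 *+ k)%R).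
  elim: k => [|k IHk]; first by rewrite mulr0n addr0 mulr1n -surjective_pairing.
  by rewrite /= IHk /fy /= -mulrnA mulrSr addrA expnSr.
have one_k l k : ((inZp 1 : 'I_l.+1) *+ k)%R = inZp k.
  by rewrite Zp_mulrn; apply: val_inj; rewrite /= modnMml mul1n.
have inZp_eq0 l k : ((inZp k : 'I_l.+1) == 0%R) = (l.+1 %| k).
  by rewrite -val_eqE.
have e_n1 (i : 'I_m.+1) : (i *+ (e ^ n.+1))%R = i.
  rewrite mulA; apply: val_inj; rewrite /= -modnMmr e_n modnMmr muln1.
  by rewrite modn_small.
have fy_inj : injective fy.
  case=> i j [i' j'] eq_f; congr (_, _);
    last exact: addIr (congr1 (fun u : T => u.2) eq_f).
  rewrite -[i]e_n1 -[i']e_n1 expnS !mulrnA; congr (_ *+ _)%R.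
  exact: (congr1 (fun u : T => u.1) eq_f).
exists {perm T}, (perm fx_inj), (perm fy_inj); split.
- apply: order_eq_dvdn => k; apply/eqP/idP => [/permP/(_ (0%R, 0%R)) | m_k].
    rewrite permX perm1 (eq_iter (permE _)) iter_fx add0r one_k.
    by move/(congr1 (fun u : T => u.1))/eqP; rewrite inZp_eq0.
  apply/permP=> u; rewrite permX perm1 (eq_iter (permE _)) iter_fx one_k.
  by rewrite (eqP (_ : inZp k == 0%R)) ?inZp_eq0 // addr0 -surjective_pairing.
- apply: order_eq_dvdn => k; apply/eqP/idP => [/permP/(_ (0%R, 0%R)) | n_k].
    rewrite permX perm1 (eq_iter (permE _)) iter_fy add0r one_k.
    by move/(congr1 (fun u : T => u.2))/eqP; rewrite inZp_eq0.
  apply/permP=> u; rewrite permX perm1 (eq_iter (permE _)) iter_fy one_k.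
  rewrite (eqP (_ : inZp k == 0%R)) ?inZp_eq0 // addr0.
  case/dvdnP: n_k => l ->; rewrite mulnC expnM [u in RHS]surjective_pairing.
  congr (_, _); elim: l => [|l IHl]; first by rewrite expn0 mulr1n.
  by rewrite expnS mulrnA e_n1.
(* Products of permutations apply the left factor first: both sides send
   (i, j) to (e * i + e, j + 1). *)
apply: (mulgI (perm fy_inj)); rewrite -conjgC; apply/permP=> u.
rewrite !permM permX (eq_iter (permE _)) iter_fx !permE /fy /fx /=.
by rewrite mulrnDl.
Qed.

Variables (gT : finGroupType) (x y : gT) (m n e : nat).
Hypotheses (ox : #[x] = m) (oy : #[y] = n) (xy : x ^ y = x ^+ e).
Hypothesis co_mn : coprime m n.

Let G := (<[x]> <*> <[y]>)%G.

Lemma metacyclic_conj k a : (x ^+ a) ^ (y ^+ k) = x ^+ (a * e ^ k).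
Proof.
elim: k => [|k IHk]; first by rewrite conjg1 muln1.
by rewrite expgSr conjgM IHk conjXg xy -expgM expnS mulnCA.
Qed.

Lemma metacyclic_normal a : <[x ^+ a]> <| G.
Proof.
have sub : <[x ^+ a]> \subset <[x]> by rewrite cycleX.
rewrite /normal (subset_trans sub) ?joing_subl //= join_subG.
rewrite (sub_abelian_norm (cycle_abelian x)) //= cycle_subG inE -cycleJ.
by rewrite cycle_subG conjXg xy -expgM mulnC expgM mem_cycle.
Qed.

Lemma metacyclic_card d :
  d %| n -> #|<[x]> <*> <[y ^+ d]>| = (m * (n %/ d))%N.
Proof.
move=> d_n; have nX : <[y ^+ d]> \subset 'N(<[x]>).
  apply: subset_trans (normal_norm (metacyclic_normal 1)).
  by rewrite (subset_trans (cycleX _ _)) ?joing_subr.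
rewrite norm_joinEr // TI_cardMg /= -?orderE ?orderXdiv ?ox ?oy //.
apply: coprime_TIg; rewrite -!orderE orderXdiv oy // ox.
exact: coprime_dvdr (dvdn_div d_n) co_mn.
Qed.

Lemma metacyclic_quotient_abelian : abelian (G / <[x]>).
Proof.
rewrite /= joingC quotientYidr ?quotient_abelian ?cycle_abelian //.
by have := normal_norm (metacyclic_normal 1); rewrite join_subG => /andP[].
Qed.

Lemma metacyclic_joing_normal d : <[x]> <*> <[y ^+ d]> <| G.
Proof.
apply: sub_der1_normal; last by rewrite genS // setUS // cycleX.
apply: subset_trans (joing_subl _ _).
rewrite der1_min ?metacyclic_quotient_abelian //.
exact: normal_norm (metacyclic_normal 1).
Qed.

Let m_gt0 : 0 < m. Proof. by rewrite -ox order_gt0. Qed.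
Let n_gt0 : 0 < n. Proof. by rewrite -oy order_gt0. Qed.

Lemma card_metacyclic : #|G| = (m * n)%N.
Proof. by have := metacyclic_card (dvd1n n); rewrite expg1 divn1. Qed.

Lemma metacyclic_index_kernel : #|G : <[x]>| = n.
Proof.
by rewrite -divgS ?joing_subl // card_metacyclic -orderE ox mulKn.
Qed.

Lemma metacyclic_kernel_adjacent p q :
    prime p -> prime q -> p != q -> p %| m -> q %| m ->
  has (fun k => p * q %| k)%N (cod G).
Proof.
move=> p_pr q_pr neq_pq p_m q_m.
have p'n r : prime r -> r %| m -> ~~ (r %| n).
  by move=> r_pr r_m; rewrite -prime_coprime // (coprime_dvdl r_m).
apply: (primes_cod_adjacent (metacyclic_normal 1) (normal1 _)) => //=;
  rewrite ?metacyclic_index_kernel ?p'n // ?indexg1 -?orderE ?ox //.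
by rewrite quotient_nil // abelian_nil // cycle_abelian.
Qed.

Lemma metacyclic_top_adjacent p q :
    prime p -> prime q -> p != q -> p %| n -> q %| n ->
  has (fun k => p * q %| k)%N (cod G).
Proof.
move=> p_pr q_pr neq_pq p_n q_n.
apply: (primes_cod_adjacent (normal_refl G) (metacyclic_normal 1)) => //=;
  rewrite ?metacyclic_index_kernel // ?indexgg ?Euclid_dvd1 //.
by rewrite abelian_nil // metacyclic_quotient_abelian.
Qed.

(** Take H = <[x]> <*> <[z]> with z = y ^+ (n %/ q) of order q, and
    K = <[x ^+ p]>.  By the congruence, z centralizes x modulo K, so H / K is
    abelian, of order p q. *)
Lemma metacyclic_mixed_adjacent p q :
    prime p -> prime q -> p %| m -> q %| n -> ~~ (q ^ 2 %| n) ->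
    e ^ (n %/ q) = 1 %[mod p] ->
  has (fun k => p * q %| k)%N (cod G).
Proof.
move=> p_pr q_pr p_m q_n q2'n e_1.
pose z := y ^+ (n %/ q); pose H := (<[x]> <*> <[z]>)%G.
have nsHG : H <| G := metacyclic_joing_normal _.
have nsKG : <[x ^+ p]> <| G := metacyclic_normal _.
have sXH : <[x]> \subset H := joing_subl _ _.
have nsKH : <[x ^+ p]> <| H.
  by apply: normalS nsKG; [apply: subset_trans sXH; apply: cycleX
                          | apply: normal_sub].
have nKx : x \in 'N(<[x ^+ p]>).
  by rewrite (subsetP (normal_norm nsKH)) // (subsetP sXH) // cycle_id.
have nKz : z \in 'N(<[x ^+ p]>).
  rewrite (subsetP (normal_norm nsKH)) // (subsetP (joing_subr _ _)) //.
  exact: cycle_id.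
have xz : commute (coset <[x ^+ p]> x) (coset <[x ^+ p]> z).
  apply/commgP; rewrite -morphR //= coset_id //.
  rewrite commgEl -{2}[x]expg1 metacyclic_conj mul1n.
  (* With e ^ (n %/ q) = p * l + 1 the commutator of x and z is x ^+ (p * l). *)
  rewrite (divn_eq (e ^ _) p) e_1 modn_small ?prime_gt1 // addn1 expgS mulKg.
  by rewrite mulnC expgM mem_cycle.
have oH : #|H| = (m * q)%N.
  by rewrite metacyclic_card ?dvdn_div // divnA ?mulKn.
have GH : #|G : H| = n %/ q.
  by rewrite -divgS ?normal_sub // card_metacyclic oH divnMl.
have p'n : ~~ (p %| n) by rewrite -prime_coprime // (coprime_dvdl p_m).
have p'GH : ~~ (p %| #|G : H|).
  by rewrite GH; apply: contra p'n => /dvdn_trans-> //; apply: dvdn_div.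
have q'GH : ~~ (q %| #|G : H|).
  rewrite GH; apply: contra q2'n => q_nq.
  by rewrite -(divnK q_n) expnS expn1 dvdn_mul.
apply: (primes_cod_adjacent nsHG nsKH) => //.
- apply: abelian_nil; rewrite /= quotientY ?cycle_subG // abelianY.
  rewrite !quotient_abelian ?cycle_abelian //= !quotient_cycle //.
  by rewrite cycle_subG /= cent_cycle; apply/cent1P.
- by apply: contraNneq p'n => ->.
- apply: dvdn_trans (indexSg (cycleX _ _) sXH).
  rewrite -divgS ?cycleX // -!orderE orderXdiv ox // divnA //.
  by rewrite mulKn.
apply: dvdn_trans (indexgS _ (cycleX x p)).
by rewrite -divgS // oH -orderE ox mulKn.
Qed.

(** Let P be the subgroup of order p of <[x]>.  If p q divided some codegree,
    then by [codegree_ndvd_primes] q would not divide |G : C_G(P)|, so the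
    normal subgroup C_G(P) would contain y ^+ (n %/ q), which has order q; but
    this element raises the elements of P to the power e ^ (n %/ q). *)
Lemma metacyclic_nonadjacent p q :
    prime p -> prime q -> p %| m -> q %| n ->
    ~~ (p ^ 2 %| m * n) -> ~~ (q ^ 2 %| m * n) ->
    e ^ (n %/ q) <> 1 %[mod p] ->
  ~~ has (fun k => p * q %| k)%N (cod G).
Proof.
move=> p_pr q_pr p_m q_n p2'mn q2'mn e_n1.
apply/hasPn=> _ /imageP[i _ ->] /=.
set z := y ^+ (n %/ q); pose P := <[x ^+ (m %/ p)]>%G.
have nsPG : P <| G := metacyclic_normal _.
have oP : #|P| = p by rewrite -orderE orderXdiv ox ?dvdn_div // divnA ?mulKn.
have C_norm : 'C_G(P) <| G.
  by have := subcent_normal G P; rewrite (setIidPl (normal_norm nsPG)).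
have q_GC : q %| #|G : 'C_G(P)|.
  apply/negPn/negP=> q'GC; case: e_n1.
  have Gz : z \in G by rewrite (subsetP (joing_subr _ _)) // mem_cycle.
  have nCz : <[z]> \subset 'N('C_G(P)).
    by rewrite cycle_subG (subsetP (normal_norm C_norm)).
  have: <[z]> \subset 'C_G(P).
    rewrite -quotient_sub1 //; apply/trivgP/card1_trivg/eqP; rewrite -dvdn1.
    rewrite -(eqP (_ : coprime q #|G : 'C_G(P)|)) ?prime_coprime // dvdn_gcd.
    apply/andP; split.
      rewrite (dvdn_trans (dvdn_quotient _ _)) // -orderE /z orderXdiv oy.
        by rewrite divnA ?mulKn.
      exact: dvdn_div.
    by rewrite -card_quotient ?normal_norm // cardSg // quotientS // cycle_subG.
  rewrite cycle_subG => /setIP[_ /centP/(_ _ (cycle_id _))].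
  move=> /esym/commgP/conjg_fixP; rewrite metacyclic_conj => /eqP.
  rewrite expgM -{2}[x ^+ (m %/ p)]expg1 eq_expg_mod_order.
  by rewrite orderE oP => /eqP.
by apply: (codegree_ndvd_primes i nsPG oP); rewrite ?card_metacyclic.
Qed.

End Metacyclic.

(** * Primes modulo which an integer has a prescribed order *)

Section PrimesWithOrders.

Local Open Scope ring_scope.

(** Phi_d and Phi_d' occur as separate factors of 'X^d - 1, which has no
    multiple root when d is invertible in K. *)
Lemma common_root_Cyclotomic_separable (K : fieldType) d d' (r : K) :
    (0 < d)%N -> d%:R != 0 :> K -> (d' %| d)%N ->
    root (map_poly intr 'Phi_d) r -> root (map_poly intr 'Phi_d') r ->
  d' = d.
Proof.
move=> d_gt0 nz_d d'_d root_d root_d'; apply/eqP; apply: contraTT nz_d => neq_d.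
apply/negP=> /separable_Xn_sub_1.
have -> : 'X^d - 1 = map_poly intr ('X^d - 1) :> {poly K}.
  by rewrite rmorphB rmorph1 /= map_polyXn.
rewrite -prod_Cyclotomic // (big_rem d) -?dvdn_divisors //=.
rewrite (big_rem d') ?mem_rem_uniq ?divisors_uniq ?inE ?neq_d
  -?dvdn_divisors //=.
rewrite !rmorphM separable_mul => /and3P[_ _ /coprimep_root/(_ root_d)].
by rewrite hornerM (eqP root_d') mul0r eqxx.
Qed.

(** Each of the equations Phi_d = 0, 1, -1 has finitely many solutions. *)
Lemma Cyclotomic_value_exists d M : (0 < d)%N -> (0 < M)%N ->
  exists x : nat, (M %| x)%N /\ (1 < `|('Phi_d).[x%:Z]|)%N.
Proof.
move=> d_gt0 M_gt0; pose P := 'Phi_d; pose Q := P * (P - 1) * (P + 1).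
have neqPc a : P != a%:P.
  apply: contra_eqN (size_Cyclotomic d) => /eqP; rewrite -/P => ->.
  by rewrite size_polyC ltn_eqF // ltnS (leq_trans (leq_b1 _)) ?totient_gt0.
have nzQ : Q != 0.
  apply: mulf_neq0; first apply: mulf_neq0.
  - by rewrite monic_neq0 ?Cyclotomic_monic.
  - by rewrite subr_eq0 -polyC1 neqPc.
  by rewrite addr_eq0 -polyC1 -polyCN neqPc.
pose rs := [seq (M * t)%N%:Z | t <- iota 1 (size Q)].
have uniq_rs : uniq rs.
  rewrite map_inj_uniq ?iota_uniq // => t u [/eqP].
  by rewrite eqn_pmul2l // => /eqP.
have: ~~ all (root Q) rs.
  apply/negP=> /(max_poly_roots nzQ)/(_ uniq_rs).
  by rewrite size_map size_iota ltnn.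
case/allPn=> _ /mapP[t _ ->] nroot.
exists (M * t)%N; rewrite dvdn_mulr //; split=> //.
move: nroot; rewrite /root /Q !hornerE -/P; case: (P.[_]) => [[|[|n]]|[|n]] //.
Qed.

(** For every d there are infinitely many primes p = 1 modulo d.  If
    |Phi_d(x)| > 1 and p is a prime divisor of Phi_d(x), then p divides
    x ^ d - 1, hence not x; choosing x divisible by d * N`! gives p > N and p
    prime to d.  If the order m of x modulo p were smaller than d, x would be a
    root modulo p of both Phi_d and some Phi_k with k dividing m. *)
Lemma prime_with_exact_order d N : (0 < d)%N ->
  exists p x : nat, [/\ prime p, (N < p)%N &
    forall k, (x ^ k == 1 %[mod p])%N = (d %| k)%N].
Proof.
move=> d_gt0; pose M := (d * N`!)%N.
have M_gt0 : (0 < M)%N by rewrite muln_gt0 d_gt0 fact_gt0.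
have [x [M_x Px]] := Cyclotomic_value_exists d_gt0 M_gt0.
pose p := pdiv `|('Phi_d).[x%:Z]|; have p_pr : prime p := pdiv_prime Px.
pose r : 'F_p := x%:R.
have root_intr n : (p%:Z %| ('Phi_n).[x%:Z])%Z = root (map_poly intr 'Phi_n) r.
  rewrite /root /r -[x%:R]/((x%:Z)%:~R) horner_map /=.
  by rewrite (dvdz_pcharf (pchar_Fp p_pr)).
have Xn1 n : (0 < n)%N ->
    \prod_(k <- divisors n) (map_poly intr 'Phi_k).[r] = r ^+ n - 1.
  move=> n_gt0; rewrite -horner_prod -rmorph_prod prod_Cyclotomic //.
  by rewrite rmorphB rmorph1 /= map_polyXn !hornerE.
have root_d : root (map_poly intr 'Phi_d) r.
  by rewrite -root_intr dvdzE pdiv_dvd.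
have r_d1 : r ^+ d = 1.
  apply/eqP; rewrite -subr_eq0 -Xn1 // (big_rem d) -?dvdn_divisors //=.
  by rewrite (eqP root_d) mul0r.
have nz_r : r != 0.
  apply: contraTneq (oner_neq0 'F_p) => r0.
  by rewrite -r_d1 r0 expr0n eqn0Ngt d_gt0 eqxx.
have F0 n : (n%:R == 0 :> 'F_p) = (p %| n)%N.
  by rewrite (dvdn_pcharf (pchar_Fp p_pr)).
have p'M : ~~ (p %| M)%N.
  by apply: contra nz_r => p_M; rewrite F0 (dvdn_trans p_M).
have [m prim_m m_d] := prim_order_exists d_gt0 r_d1.
have m_gt0 := prim_order_gt0 prim_m.
have eq_md : m = d.
  have /eqP := Xn1 m m_gt0; rewrite prim_expr_order // subrr.
  rewrite prodf_seq_eq0 => /hasP[k]; rewrite -dvdn_divisors // => k_m /= root_k.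
  have k_d : k = d.
    apply: (common_root_Cyclotomic_separable d_gt0 _ _ root_d root_k).
      by rewrite F0; apply: contra p'M => p_d; rewrite dvdn_mulr.
    exact: dvdn_trans k_m m_d.
  by apply/eqP; rewrite eqn_dvd m_d -k_d.
exists p, x; split=> // [|k].
  rewrite ltnNge; apply: contra p'M => le_pN.
  by rewrite dvdn_mull // dvdn_fact // prime_gt0.
rewrite -eq_md (prim_order_dvd prim_m) -natrX -[1]/(1%:R) -val_eqE.
by rewrite ![val _](val_Fp_nat p_pr).
Qed.

End PrimesWithOrders.

(** The primes are chosen one after the other, each larger than the product of
    the previous ones, so that the Chinese remainder theorem applies. *)
Lemma primes_with_exact_orders (I : eqType) (s : seq I) (d : I -> nat) N :
    uniq s -> (forall i, 0 < d i) ->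
  exists (p : I -> nat) (e : nat),
    [/\ {in s, forall i, prime (p i)}, {in s, forall i, N < p i},
        {in s &, injective p} &
        {in s, forall i k, (e ^ k == 1 %[mod p i]) = (d i %| k)}].
Proof.
move=> + d_gt0; elim: s => [|i s IHs] /=; first by exists (fun=> 0), 0.
case/andP=> s'i /IHs[p [e [p_pr ltNp p_inj e_ord]]].
pose m := \prod_(j <- s) p j.
have m_gt0 : 0 < m.
  by rewrite /m big_seq; apply: prodn_cond_gt0 => j /p_pr/prime_gt0.
have [p' [x [p'_pr ltNp' x_ord]]] :=
  prime_with_exact_order (maxn N m) (d_gt0 i).
rewrite gtn_max in ltNp'; case/andP: ltNp' => ltNp' lt_mp'.
have p_m j : j \in s -> p j %| m.
  by move=> sj; rewrite /m (big_rem j) //= dvdn_mulr.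
have co_mp' : coprime m p' by rewrite coprime_sym prime_coprime // gtnNdvd.
have p'_p j : j \in s -> p' != p j.
  by move=> sj; rewrite gtn_eqF // (leq_ltn_trans _ lt_mp') // dvdn_leq ?p_m.
exists (fun j => if j == i then p' else p j), (chinese m p' e x).
have neq_i j : j \in s -> (j == i) = false.
  by move=> sj; apply: contraNF s'i => /eqP<-.
split=> [j|j|j k|j] /[!inE].
- by case: eqP => //= _; apply: p_pr.
- by case: eqP => //= _; apply: ltNp.
- case/predU1P=> [-> | sj] /predU1P[-> | sk] //.
  + by rewrite eqxx neq_i // => /eqP; rewrite (negPf (p'_p _ sk)).
  + by rewrite eqxx neq_i // => /esym/eqP; rewrite (negPf (p'_p _ sj)).
  by rewrite !neq_i //; apply: p_inj.
case/predU1P=> [-> | sj] k.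
  by rewrite eqxx -x_ord -modnXm (chinese_modr co_mp') modnXm.
have eq_e : chinese m p' e x = e %[mod p j].
  by rewrite -(modn_dvdm _ (p_m j sj)) (chinese_modl co_mp') modn_dvdm ?p_m.
by rewrite neq_i // -e_ord // -modnXm eq_e modnXm.
Qed.

Section GraphArithmetic.

Variables (V : finType) (c : pred V) (r : rel V).

(** The residue e has order d_v modulo p_v, where d_v is the product of
    those factors q_w of n for which r v w fails.  As n %/ q_w is the product of
    the other factors of n, d_v divides it exactly when q_w is not a factor of
    d_v. *)
Lemma graph_primes_exist :
  exists (p q : V -> nat) (e : nat),
    [/\ forall v, prime (p v) /\ prime (q v), injective p, injective q,
        forall v w, p v != q w &
        let n := \prod_(w | ~~ c w) q w in
        (forall v, e ^ n = 1 %[mod p v]) /\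
        (forall v w, ~~ c w -> (e ^ (n %/ q w) == 1 %[mod p v]) = r v w)].
Proof.
have enumV v : v \in enum V by rewrite mem_enum.
(* Only distinct primes are wanted here, so all prescribed orders are 1. *)
have [q [_ [q_pr _ q_inj _]]] :=
  primes_with_exact_orders 0 (enum_uniq V) (fun=> ltn0Sn 0).
pose d v := \prod_(w | ~~ c w && ~~ r v w) q w.
have q_gt0 w : 0 < q w by rewrite prime_gt0 ?q_pr.
have d_gt0 v : 0 < d v by apply: prodn_gt0.
have [p [e [p_pr lt_p p_inj e_ord]]] :=
  primes_with_exact_orders (\max_v q v) (enum_uniq V) d_gt0.
exists p, q, e; split.
- by move=> v; rewrite p_pr ?q_pr.
- by move=> v w; apply: p_inj.
- by move=> v w; apply: q_inj.
- move=> v w; rewrite gtn_eqF // (leq_ltn_trans _ (lt_p v _)) //.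
  exact: leq_bigmax.
split=> [v | v w c'w].
  apply/eqP; rewrite e_ord // (bigID (r v)) /= mulnC dvdn_mulr //.
rewrite e_ord //; pose m := \prod_(u | ~~ c u && (u != w)) q u.
have -> : \prod_(u | ~~ c u) q u %/ q w = m by rewrite (bigD1 w) //= mulKn.
have [rvw | r'vw] := boolP (r v w).
  rewrite /m (bigID (r v)) /= dvdn_mull //.
  rewrite [X in _ %| X](eq_bigl (fun u => ~~ c u && ~~ r v u)) // => u.
  by case: eqVneq => [->|]; rewrite ?rvw ?andbF ?andbT.
apply/negP=> d_m; have: q w %| m.
  by rewrite (dvdn_trans _ d_m) // /d (bigD1 w) /= ?c'w // dvdn_mulr.
rewrite /m; elim/big_rec: _ => [|u a /andP[_ neq_uw] IH].
  by rewrite Euclid_dvd1 ?q_pr.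
rewrite Euclid_dvdM ?q_pr // => /orP[|//].
rewrite dvdn_prime2 ?q_pr // => /eqP/q_inj eq_wu.
by rewrite eq_wu ?eqxx in neq_uw.
Qed.

End GraphArithmetic.

(** * Realizing graphs by groups of square-free order *)

Section PrimeProducts.

Variables (I : finType) (p : I -> nat).
Hypotheses (p_pr : forall i, prime (p i)) (p_inj : injective p).

Lemma prime_dvd_primes_prod (P : pred I) r :
  prime r -> r %| \prod_(i | P i) p i -> exists2 i, P i & r = p i.
Proof.
move=> r_pr; rewrite Euclid_dvd_prod // big_orE => /existsP[i /andP[Pi]].
by rewrite dvdn_prime2 // => /eqP->; exists i.
Qed.

Lemma primes_prod_sqfree (P : pred I) r :
  prime r -> ~~ (r ^ 2 %| \prod_(i | P i) p i).
Proof.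
move=> r_pr; apply/negP=> r2_dvd.
have r_dvd := dvdn_trans (dvdn_exp2l r (leqnSn 1)) r2_dvd.
have [i Pi def_r] := prime_dvd_primes_prod r_pr r_dvd.
move: r2_dvd; rewrite (bigD1 i) //= -def_r expnS expn1 dvdn_pmul2l ?prime_gt0 //.
case/(prime_dvd_primes_prod r_pr)=> j /andP[_ /eqP neq_ji].
by rewrite def_r => /p_inj eq_ij; case: neq_ji.
Qed.

Lemma eq_mod_primes_prod (P : pred I) a b :
    (forall i, P i -> a = b %[mod p i]) ->
  a = b %[mod \prod_(i | P i) p i].
Proof.
move=> eq_ab; rewrite -big_enum /=.
have: {in enum P, forall i, a = b %[mod p i]}.
  by move=> i; rewrite mem_enum => /eq_ab.
elim: (enum P) (enum_uniq P) => [|i s IHs] /=; first by rewrite big_nil !modn1.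
case/andP=> s'i uniq_s eq_s; apply/eqP; rewrite big_cons chinese_remainder.
  rewrite eq_s ?mem_head // eqxx /=; apply/eqP/IHs => // j sj.
  by rewrite eq_s // inE sj orbT.
rewrite prime_coprime // Euclid_dvd_prod // big_has.
apply: contra s'i => /hasP[j sj]; rewrite dvdn_prime2 // => /eqP/p_inj->.
exact: sj.
Qed.

End PrimeProducts.

Section Realization.

Variables (F : sgraph) (c : F -> bool).
Hypothesis c_col : forall v w, @edge (compl_graph F) v w -> c v != c w.

(** The color class of v decides whether v is represented by a prime divisor of
    #[x] or of #[y]; vertices of one color are adjacent in F because c colors
    the complement. *)
Lemma square_free_realization :
  exists (gT : finGroupType) (G : {group gT}),
    square_free #|G| /\ graph_iso F (Delta_cod G).
Proof.
have [p [q [e [pq_pr p_inj q_inj neq_pq]]]] := graph_primes_exist c (@edge F).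
pose m := \prod_(v | c v) p v; pose n := \prod_(w | ~~ c w) q w.
rewrite -/n => -[e_n e_edge].
have p_pr v : prime (p v) by case: (pq_pr v).
have q_pr v : prime (q v) by case: (pq_pr v).
have m_gt0 : 0 < m by apply: prodn_gt0 => v; apply: prime_gt0.
have n_gt0 : 0 < n by apply: prodn_gt0 => v; apply: prime_gt0.
have e_m : e ^ n = 1 %[mod m] by apply: eq_mod_primes_prod.
have p_m v : c v -> p v %| m.
  by move=> cv; rewrite /m (bigD1 v) //= dvdn_mulr.
have q_n v : ~~ c v -> q v %| n.
  by move=> cv; rewrite /n (bigD1 v) //= dvdn_mulr.
have dvd_m r : prime r -> r %| m -> exists2 v, c v & r = p v.
  exact: prime_dvd_primes_prod.
have dvd_n r : prime r -> r %| n -> exists2 v, ~~ c v & r = q v.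
  exact: prime_dvd_primes_prod.
have m_sqf r : prime r -> ~~ (r ^ 2 %| m) by apply: primes_prod_sqfree.
have n_sqf r : prime r -> ~~ (r ^ 2 %| n) by apply: primes_prod_sqfree.
have no_common r : prime r -> r %| m -> ~~ (r %| n).
  move=> r_pr /(dvd_m r r_pr)[v _ def_r]; apply/negP=> /(dvd_n r r_pr)[w _].
  by apply/eqP; rewrite def_r.
have co_mn : coprime m n.
  apply: contraT => nco; have r_pr : prime (pdiv (gcdn m n)).
    by rewrite pdiv_prime // ltn_neqAle eq_sym nco gcdn_gt0 m_gt0.
  have := pdiv_dvd (gcdn m n); rewrite dvdn_gcd.
  by case/andP=> /(no_common _ r_pr)/negPf->.
have [gT [x [y [ox oy xy]]]] := split_metacyclic_exists m_gt0 n_gt0 e_m.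
pose G := (<[x]> <*> <[y]>)%G.
have oG : #|G| = (m * n)%N := card_metacyclic ox oy xy co_mn.
exists gT, G; split.
  by apply: square_free_primes => r r_pr; rewrite oG sqfree_mul ?m_sqf ?n_sqf.
pose label v := if c v then p v else q v.
have label_inj : injective label.
  move=> v w; rewrite /label; case: (c v) (c w) => [] [] eq_vw.
  - exact: p_inj eq_vw.
  - by case/eqP: (neq_pq v w).
  - by case/eqP: (neq_pq w v).
  exact: q_inj eq_vw.
have label_cod v : label v \in cod_primes G.
  have nsX : (<[x]> <| G)%g := metacyclic_normal xy 1.
  rewrite /label; case: (boolP (c v)) => [cv | c'v].
    apply: (prime_mem_cod_primes nsX (normal1 _)) => //.
    - by rewrite quotient_nil // abelian_nil // cycle_abelian.
    - by rewrite indexg1 -orderE ox p_m.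
    by rewrite (metacyclic_index_kernel ox oy xy co_mn) // no_common ?p_m.
  apply: (prime_mem_cod_primes (normal_refl G) nsX) => //.
  - by rewrite abelian_nil // (metacyclic_quotient_abelian xy).
  - by rewrite (metacyclic_index_kernel ox oy xy co_mn) // q_n.
  by rewrite indexgg Euclid_dvd1.
have label_onto r : prime r -> r %| #|G| -> exists v, r = label v.
  move=> r_pr; rewrite oG Euclid_dvdM //.
  case/orP=> [/(dvd_m r r_pr) | /(dvd_n r r_pr)].
    by case=> v cv ->; exists v; rewrite /label cv.
  by case=> v /negPf cv ->; exists v; rewrite /label cv.
have same_color v w : v != w -> c v = c w -> edge v w.
  move=> neq_vw eq_c; apply: contraT => nadj.
  by have /c_col : @edge (compl_graph F) v w by [apply/andP]; rewrite eq_c eqxx.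
have mixed v w : c v -> ~~ c w ->
  has (fun k => p v * q w %| k)%N (cod G) = edge v w.
  move=> cv c'w; rewrite -e_edge //; apply/idP/eqP.
    apply: contraTeq => /eqP ne1.
    by apply: (metacyclic_nonadjacent ox oy xy co_mn);
      rewrite ?p_m ?q_n ?sqfree_mul ?m_sqf ?n_sqf.
  by apply: (metacyclic_mixed_adjacent ox oy xy co_mn);
    rewrite ?p_m ?q_n ?n_sqf.
pose f v : Delta_cod G := SeqSub (label_cod v).
have f_inj : injective f by move=> v w /(congr1 val)/label_inj.
exists f.
  apply: (inj_card_bij f_inj); rewrite -(card_codom f_inj) subset_leq_card //.
  apply/subsetP=> u _; have [u_pr u_G] := cod_primes_dvd (valP u).
  have [v def_u] := label_onto _ u_pr u_G.
  by apply/codomP; exists v; apply: val_inj.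
move=> v w; have [-> | neq_vw] := eqVneq v w; first by rewrite !edge_irr.
rewrite /edge /= /cod_edge /= (inj_eq f_inj) neq_vw /= -/(edge v w) /label.
case: (boolP (c v)) (boolP (c w)) => [cv | c'v] [cw | c'w].
- rewrite same_color ?cv ?cw //.
  by apply: (metacyclic_kernel_adjacent ox oy xy co_mn);
    rewrite ?p_m ?(inj_eq p_inj).
- exact: mixed.
- by rewrite edge_sym -mixed //; apply: eq_has => k; rewrite mulnC.
rewrite same_color ?(negPf c'v) ?(negPf c'w) //.
by apply: (metacyclic_top_adjacent ox oy xy co_mn);
  rewrite ?q_n ?(inj_eq q_inj).
Qed.

End Realization.

Theorem proposition3p6
  (C : forall gT : finGroupType, {group gT} -> Prop)
  (square_free_C : forall (gT : finGroupType) (G : {group gT}),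
    square_free #|G| -> C gT G)
  (C_metanilpotent : forall (gT : finGroupType) (G : {group gT}),
    C gT G -> metanilpotent G)
  (F : sgraph) :
  (exists (gT : finGroupType) (G : {group gT}),
     C gT G /\ graph_iso F (Delta_cod G))
  <-> bipartite (compl_graph F).
Proof.
split=> [[gT [G [C_G isoFG]]] | [c c_col]].
  apply: graph_iso_compl_bipartite isoFG _.
  exact: metanilpotent_compl_bipartite (C_metanilpotent gT G C_G).
have [gT [G [sqfG isoFG]]] := square_free_realization c_col.
by exists gT, G; split=> //; apply: square_free_C.
Qed.
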